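(* Let $N$ be a $2n$-dimensional smooth manifold, $\nabla$ a linear connection on $N$ with torsion tensor $T^{\nabla}$, $g$ a pseudo-Riemannian metric on $N$, $J$ an almost complex structure on $N$, and suppose that $(g,\omega,J)$ is a compatible triple. Assume that $T^{\nabla}$ satisfies the torsion-compatibility condition $T^{\nabla}(X,JY)=-T^{\nabla}(JX,Y)$ for all vector fields $X,Y$. If $d^{\nabla}J=0$ and $(N,g,\nabla)$ is a quasi-statistical manifold (i.e. $d^{\nabla}g=0$), then $(N,g,\nabla,J)$ is a Kähler manifold, that is, $J$ is integrable and $d\omega=0$.
   Context: An almost complex structure is a $(1,1)$-tensor field $J$ with $J^2=-\mathrm{id}$. ''Compatible triple'' $(g,\omega,J)$: $g$ is a pseudo-Riemannian metric with $g(JX,JY)=g(X,Y)$ for all $X,Y$ (equivalently $g(JX,Y)=-g(X,JY)$), and $\omega$ is the fundamental $2$-form $\omega(X,Y)=g(JX,Y)$. The torsion is $T^{\nabla}(X,Y)=\nabla_XY-\nabla_YX-[X,Y]$. With $(\nabla_XJ)Y=\nabla_X(JY)-J\nabla_XY$, define $(d^{\nabla}J)(X,Y)=(\nabla_XJ)Y-(\nabla_YJ)X+J\,T^{\nabla}(X,Y)$. Define $(d^{\nabla}g)(X,Y,Z)=(\nabla_Xg)(Y,Z)-(\nabla_Yg)(X,Z)+g(T^{\nabla}(X,Y),Z)$. $(N,g,\nabla)$ is a quasi-statistical manifold (statistical manifold admitting torsion) if $d^{\nabla}g=0$. $J$ is integrable if its Nijenhuis tensor $N_J(X,Y)=-J^2[X,Y]+J[X,JY]+J[JX,Y]-[JX,JY]$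 vanishes. The metric $g$ in a Kähler manifold is here allowed to be pseudo-Riemannian. *)

(* Defs.v *)
From HB Require Import structures.
From mathcomp Require Import all_boot all_order all_algebra.
From mathcomp Require Import all_classical all_reals all_analysis.
From mathcomp Require Import ring.
Set Implicit Arguments.
Unset Strict Implicit.
Unset Printing Implicit Defensive.
Import Order.TTheory GRing.Theory Num.Theory.
Import numFieldNormedType.Exports.
Local Open Scope classical_set_scope.
Local Open Scope ring_scope.

(* f is of class C^k on U, meant for U open: the iterated partial derivatives
   up to order k exist and are continuous at every point of U. *)
Fixpoint ck_on (R : realType) (m : nat) (W : normedModType R) (k : nat)
    (U : set 'rV[R]_m) (f : 'rV[R]_m -> W) : Prop :=
  {in U, continuous f} /\
  if k is k'.+1 then
    forall i : 'I_m, {in U, forall x, derivable f x (delta_mx 0 i)} /\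
      ck_on k' U ('D_(delta_mx 0 i) f)
  else True.

Definition smooth_on (R : realType) (m : nat) (W : normedModType R)
  (U : set 'rV[R]_m) (f : 'rV[R]_m -> W) := forall k, ck_on k U f.

Section ck_on_theory.
Variables (R : realType) (m : nat) (U : set 'rV[R]_m).
Hypothesis oU : open U.

Lemma in_open_near x : x \in U -> \near x, U x.
Proof. by rewrite inE => Ux; exact: open_nbhs_nbhs. Qed.

Lemma ck_on_cont (W : normedModType R) k (f : 'rV[R]_m -> W) :
  ck_on k U f -> {in U, continuous f}.
Proof. by case: k => [|k] []. Qed.

Lemma ck_onW (W : normedModType R) k (f : 'rV[R]_m -> W) :
  ck_on k.+1 U f -> ck_on k U f.
Proof.
elim: k f => [|k IH] f [fc fd]; split => // i.
by have [d1 /IH d2] := fd i.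
Qed.

Lemma ck_on_eq (W : normedModType R) k (f g : 'rV[R]_m -> W) :
  {in U, f =1 g} -> ck_on k U f -> ck_on k U g.
Proof.
have eqnear (f' g' : 'rV[R]_m -> W) : {in U, f' =1 g'} ->
    forall x, x \in U -> \near x, f' x = g' x.
  move=> fg x /in_open_near; apply: filterS => y Uy.
  by apply: fg; rewrite inE.
have conteq (f' g' : 'rV[R]_m -> W) : {in U, f' =1 g'} ->
    {in U, continuous f'} -> {in U, continuous g'}.
  move=> fg fc x Ux; have := fc x Ux.
  rewrite /continuous_at (fg x Ux) => H.
  exact: cvg_trans (near_eq_cvg (F := nbhs x) (eqnear _ _ fg x Ux)) H.
elim: k f g => [|k IH] f g fg [fc fd]; split => //; try exact: conteq fc.
move=> i; have [d1 d2] := fd i.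
split=> [x Ux|].
  by apply: near_eq_derivable (d1 x Ux); exact: eqnear _ _ fg x Ux.
apply: IH d2 => x Ux /=.
by apply: near_eq_derive; exact: eqnear _ _ fg x Ux.
Qed.

Lemma ck_on_cst (W : normedModType R) k (a : W) :
  ck_on k U (cst a : 'rV[R]_m -> W).
Proof.
elim: k a => [|k IH] a; split => //; try by move=> x _; exact: cst_continuous.
move=> i; split=> [x _|]; first exact: derivable_cst.
by apply: ck_on_eq (IH 0) => x _; rewrite derive_cst.
Qed.

Lemma ck_onD (W : normedModType R) k (f g : 'rV[R]_m -> W) :
  ck_on k U f -> ck_on k U g -> ck_on k U (f + g).
Proof.
elim: k f g => [|k IH] f g [fc fd] [gc gd]; split=> //;
  try by move=> x Ux; apply: continuousD; [exact: fc|exact: gc].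
move=> i; have [d1 d2] := fd i; have [e1 e2] := gd i.
split=> [x Ux|]; first by apply: derivableD; [exact: d1|exact: e1].
apply: ck_on_eq (IH _ _ d2 e2) => x Ux.
by rewrite deriveD //; [exact: d1|exact: e1].
Qed.

Lemma ck_onM k (f g : 'rV[R]_m -> R^o) :
  ck_on k U f -> ck_on k U g -> ck_on k U (f * g : _ -> R^o).
Proof.
elim: k f g => [|k IH] f g.
  move=> [fc _] [gc _]; split=> // x Ux.
  by apply: continuousM; [exact: fc|exact: gc].
move=> cf cg; split=> [x Ux|i].
  by apply: continuousM; [exact: (ck_on_cont cf)|exact: (ck_on_cont cg)].
have [d1 d2] := cf.2 i; have [e1 e2] := cg.2 i.
split=> [x Ux|]; first by apply: derivableM; [exact: d1|exact: e1].
apply: ck_on_eq (ck_onD (IH _ _ (ck_onW cf) e2) (IH _ _ (ck_onW cg) d2)) => x Ux.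
by rewrite deriveM //; [exact: d1|exact: e1].
Qed.

End ck_on_theory.

(* [cinv] is a total function; only its values on [cmap @` cdom], where it is
   the inverse of [cmap], are constrained. *)
Record chart (R : realType) (m : nat) (T : topologicalType) := Chart {
  cdom : set T;
  cmap : T -> 'rV[R]_m;
  cinv : 'rV[R]_m -> T;
  open_cdom : open cdom;
  open_cmap_cdom : open (cmap @` cdom);
  cmapK : {in cdom, cancel cmap cinv};
  cmap_continuous : {in cdom, continuous cmap};
  cinv_continuous : {in cmap @` cdom, continuous cinv} }.

Record manifold (R : realType) (m : nat) := Manifold {
  carrier :> topologicalType;
  hausdorff_carrier : hausdorff_space carrier;
  second_countable_carrier : @second_countable carrier;
  atlas : set (chart R m carrier);
  atlas_cover : forall p : carrier, exists2 c, atlas c & cdom c p;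
  atlas_smooth : forall c c', atlas c -> atlas c' ->
    smooth_on (cmap c @` (cdom c `&` cdom c')) (cmap c' \o cinv c) }.

Section smooth_functions.
Variables (R : realType) (m : nat) (M : manifold R m).

Definition smooth (f : M -> R) : Prop :=
  forall c, atlas c -> smooth_on (cmap c @` cdom c) ((f : M -> R^o) \o cinv c).

Definition smooth_pred : {pred M -> R^o} := fun f => `[< smooth f >].

Record Cinf := MkCinf { cval :> M -> R^o; _ : cval \in smooth_pred }.

Lemma smooth_cst (a : R) : smooth (cst a).
Proof. by move=> c _ k; apply: ck_on_cst; exact: open_cmap_cdom. Qed.

Lemma smoothD f g : smooth f -> smooth g -> smooth (f + g).
Proof.
move=> sf sg c cA k.
exact: (ck_onD (@open_cmap_cdom _ _ _ c) (sf c cA k) (sg c cA k)).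
Qed.

Lemma smoothM f g : smooth f -> smooth g -> smooth (f * g).
Proof.
move=> sf sg c cA k.
exact: (ck_onM (@open_cmap_cdom _ _ _ c) (sf c cA k) (sg c cA k)).
Qed.

Lemma smoothZ a f : smooth f -> smooth (a *: (f : M -> R^o)).
Proof. by move=> sf; exact: (smoothM (smooth_cst a) sf). Qed.

Lemma smoothN f : smooth f -> smooth (- f).
Proof. by rewrite -(scaleN1r (f : M -> R^o)); exact: smoothZ. Qed.

Fact smooth_subring : subring_closed smooth_pred.
Proof.
split=> [|f g|f g].
- by apply/asboolP; exact: smooth_cst.
- by move=> /asboolP sf /asboolP sg; apply/asboolP; apply: smoothD => //; exact: smoothN.
- by move=> /asboolP sf /asboolP sg; apply/asboolP; exact: smoothM.
Qed.

Fact smooth_scaler : scaler_closed smooth_pred.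
Proof. by move=> a f /asboolP sf; apply/asboolP; exact: smoothZ. Qed.

HB.instance Definition _ :=
  GRing.isSubringClosed.Build (M -> R^o) smooth_pred smooth_subring.
HB.instance Definition _ :=
  GRing.isScaleClosed.Build R (M -> R^o) smooth_pred smooth_scaler.
HB.instance Definition _ := [isSub for cval].
HB.instance Definition _ := [Choice of Cinf by <:].
HB.instance Definition _ := 
  GRing.SubChoice_isSubComPzRing.Build _ _ Cinf (subringClosedP _).
HB.instance Definition _ := [SubZmodule_isSubLmodule of Cinf by <:].

Definition mk_Cinf (f : M -> R) (sf : smooth f) : Cinf :=
  @MkCinf f (asboolT sf).

Lemma Cinf_smooth (f : Cinf) : smooth f.
Proof. by case: f => f /= /asboolP. Qed.

Lemma CinfP (f g : Cinf) : (forall p, f p = g p) -> f = g.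
Proof. by move=> fg; apply/val_inj/funext. Qed.

End smooth_functions.

Section tangent_space.
Variables (R : realType) (m : nat) (M : manifold R m) (p : M).

Definition derivation_at (v : Cinf M -> R^o) : Prop :=
  linear v /\ forall f g, v (f * g) = f p * v g + g p * v f.

Definition derivation_pred : {pred Cinf M -> R^o} :=
  fun v => `[< derivation_at v >].

Fact derivation_submod : submod_closed derivation_pred.
Proof.
split=> [|a u v /asboolP[ul uM] /asboolP[vl vM]]; apply/asboolP; split.
- by move=> b f g; rewrite /= scaler0 addr0.
- by move=> f g; rewrite /= !mulr0 addr0.
- move=> b f g; rewrite /= !fctE ul vl !scalerDr !scalerA (mulrC a b).
  by rewrite addrACA.
- move=> f g; rewrite /= !fctE uM vM /GRing.scale /=; ring.
Qed.

HB.instance Definition _ :=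
  GRing.isSubmodClosed.Build R (Cinf M -> R^o) derivation_pred
    derivation_submod.

Record tangent := Tangent {
  tval :> Cinf M -> R^o; _ : tval \in derivation_pred }.

HB.instance Definition _ := [isSub for tval].
HB.instance Definition _ := [Choice of tangent by <:].
HB.instance Definition _ := [SubChoice_isSubLmodule of tangent by <:].

Definition mk_tangent (v : Cinf M -> R) (dv : derivation_at v) : tangent :=
  @Tangent v (asboolT dv).

Lemma tangent_derivation (v : tangent) : derivation_at v.
Proof. by case: v => v /= /asboolP. Qed.

Lemma tangentP (u v : tangent) : (forall f, u f = v f) -> u = v.
Proof. by move=> uv; apply/val_inj/funext. Qed.

End tangent_space.

Section vector_fields.
Variables (R : realType) (m : nat) (M : manifold R m).

Definition smooth_section (s : forall p : M, tangent p) : Prop :=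
  forall f : Cinf M, smooth (fun p => s p f).

Record vfield := VField {
  vf :> forall p : M, tangent p; vf_smooth : smooth_section vf }.

Lemma vfieldP (X Y : vfield) : (forall p, X p = Y p) -> X = Y.
Proof.
case: X Y => [X sX] [Y sY] /= XY.
have {}XY : X = Y by exact: functional_extensionality_dep.
by rewrite -XY in sY *; congr VField; exact: Prop_irrelevance.
Qed.

(* The function p |-> X_p f, written X f in textbooks. *)
Definition vact (X : vfield) (f : Cinf M) : Cinf M := mk_Cinf (vf_smooth X f).

Lemma smooth_section0 : smooth_section (fun p => 0).
Proof. by move=> f; exact: smooth_cst. Qed.

Lemma smooth_sectionD (X Y : vfield) : smooth_section (fun p => X p + Y p).
Proof. by move=> f; exact: smoothD (vf_smooth X f) (vf_smooth Y f). Qed.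

Lemma smooth_sectionN (X : vfield) : smooth_section (fun p => - X p).
Proof. by move=> f; exact: smoothN (vf_smooth X f). Qed.

Lemma smooth_sectionZ (h : Cinf M) (X : vfield) :
  smooth_section (fun p => h p *: X p).
Proof. by move=> f; exact: smoothM (Cinf_smooth h) (vf_smooth X f). Qed.

Definition vadd X Y : vfield := VField (smooth_sectionD X Y).
Definition vopp X : vfield := VField (smooth_sectionN X).
Definition vscale h X : vfield := VField (smooth_sectionZ h X).

HB.instance Definition _ := gen_eqMixin vfield.
HB.instance Definition _ := gen_choiceMixin vfield.

Fact vaddA : associative vadd.
Proof. by move=> X Y Z; apply: vfieldP => p /=; rewrite addrA. Qed.
Fact vaddC : commutative vadd.
Proof. by move=> X Y; apply: vfieldP => p /=; rewrite addrC. Qed.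
Fact vadd0 : left_id (VField smooth_section0) vadd.
Proof. by move=> X; apply: vfieldP => p /=; rewrite add0r. Qed.
Fact vaddN : left_inverse (VField smooth_section0) vopp vadd.
Proof. by move=> X; apply: vfieldP => p /=; rewrite addNr. Qed.

HB.instance Definition _ :=
  GRing.isZmodule.Build vfield vaddA vaddC vadd0 vaddN.

Fact vscaleA a b X : vscale a (vscale b X) = vscale (a * b) X.
Proof. by apply: vfieldP => p /=; rewrite scalerA. Qed.
Fact vscale1 : left_id 1 vscale.
Proof. by move=> X; apply: vfieldP => p /=; rewrite scale1r. Qed.
Fact vscaleDr : right_distributive vscale +%R.
Proof. by move=> a X Y; apply: vfieldP => p /=; rewrite scalerDr. Qed.
Fact vscaleDl X : {morph vscale^~ X : a b / a + b}.
Proof. by move=> a b; apply: vfieldP => p /=; rewrite scalerDl. Qed.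

HB.instance Definition _ := GRing.Zmodule_isLmodule.Build (Cinf M) vfield
  vscaleA vscale1 vscaleDr vscaleDl.

Fact lie_derivation (X Y : vfield) (p : M) :
  derivation_at p (fun f => X p (vact Y f) - Y p (vact X f)).
Proof.
have act_lin (Z : vfield) a f g :
    vact Z (a *: f + g) = a *: vact Z f + vact Z g.
  by apply: CinfP => q; have [+ _] := tangent_derivation (Z q); apply.
have act_leib (Z : vfield) f g :
    vact Z (f * g) = f * vact Z g + g * vact Z f.
  by apply: CinfP => q; have [_ +] := tangent_derivation (Z q); apply.
have [Xl XM] := tangent_derivation (X p).
have [Yl YM] := tangent_derivation (Y p).
have XD f g : X p (f + g) = X p f + X p g.
  by have := Xl 1 f g; rewrite !scale1r.
have YD f g : Y p (f + g) = Y p f + Y p g.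
  by have := Yl 1 f g; rewrite !scale1r.
split=> [a f g|f g].
  rewrite !act_lin Xl Yl scalerBr opprD !addrA; congr (_ - _).
  by rewrite addrAC.
rewrite !act_leib XD YD !XM !YM /=; ring.
Qed.

Fact lie_smooth (X Y : vfield) :
  smooth_section (fun p => mk_tangent (lie_derivation X Y p)).
Proof.
move=> f; exact: smoothD (vf_smooth X _) (smoothN (vf_smooth Y _)).
Qed.

Definition lie (X Y : vfield) : vfield := VField (lie_smooth X Y).

End vector_fields.

(* Tensor fields are given pointwise; smoothness is tested on smooth vector
   fields. *)
Record tensor11 (R : realType) (m : nat) (M : manifold R m) := Tensor11 {
  t11 : forall p : M, {linear tangent p -> tangent p};
  t11_smooth : forall X : vfield M, smooth_section (fun p => t11 p (X p)) }.

Record tensor02 (R : realType) (m : nat) (M : manifold R m) := Tensor02 {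
  t02 : forall p : M, tangent p -> tangent p -> R;
  t02_linearl : forall (p : M) (v : tangent p),
    linear (fun u : tangent p => t02 u v : R^o);
  t02_linearr : forall (p : M) (u : tangent p),
    linear (fun v : tangent p => t02 u v : R^o);
  t02_smooth : forall X Y : vfield M, smooth (fun p => t02 (X p) (Y p)) }.

Definition t11_app (R : realType) (m : nat) (M : manifold R m)
  (J : tensor11 M) (X : vfield M) : vfield M := VField (t11_smooth J X).
Coercion t11_app : tensor11 >-> Funclass.

Definition t02_app (R : realType) (m : nat) (M : manifold R m)
  (g : tensor02 M) (X Y : vfield M) : Cinf M := mk_Cinf (t02_smooth g X Y).
Coercion t02_app : tensor02 >-> Funclass.

Record connection (R : realType) (m : nat) (M : manifold R m) := Connection {
  nabla :> vfield M -> vfield M -> vfield M;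
  nabla_linearl : forall Y, linear (nabla ^~ Y);
  nabla_addr : forall X Y Z, nabla X (Y + Z) = nabla X Y + nabla X Z;
  nabla_leibniz : forall X (f : Cinf M) Y,
    nabla X (f *: Y) = f *: nabla X Y + vact X f *: Y }.

Section structures.
Variables (R : realType) (m : nat) (M : manifold R m).
Implicit Types (X Y Z : vfield M) (D : connection M).
Implicit Types (g w : tensor02 M) (J : tensor11 M).

(* No condition is put on the signature, which may differ from one connected
   component to another. *)
Definition pseudo_riemannian g : Prop :=
  forall p : M, (forall u v : tangent p, t02 g u v = t02 g v u) /\
    (forall u : tangent p, (forall v, t02 g u v = 0) -> u = 0).

Definition almost_complex J : Prop :=
  forall (p : M) (v : tangent p), t11 J p (t11 J p v) = - v.

Definition compatible_triple g w J : Prop :=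
  (forall X Y, g (J X) (J Y) = g X Y) /\ (forall X Y, w X Y = g (J X) Y).

Definition torsion D X Y : vfield M := D X Y - D Y X - lie X Y.

Definition nablaJ D J X Y : vfield M := D X (J Y) - J (D X Y).

Definition d_nablaJ D J X Y : vfield M :=
  nablaJ D J X Y - nablaJ D J Y X + J (torsion D X Y).

Definition nablag D g X Y Z : Cinf M :=
  vact X (g Y Z) - g (D X Y) Z - g Y (D X Z).

Definition d_nablag D g X Y Z : Cinf M :=
  nablag D g X Y Z - nablag D g Y X Z + g (torsion D X Y) Z.

Definition quasi_statistical D g : Prop :=
  forall X Y Z, d_nablag D g X Y Z = 0.

Definition nijenhuis J X Y : vfield M :=
  - J (J (lie X Y)) + J (lie X (J Y)) + J (lie (J X) Y) - lie (J X) (J Y).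

Definition integrable J : Prop := forall X Y, nijenhuis J X Y = 0.

(* Invariant formula for the exterior derivative of a 2-form w. *)
Definition d_form2 w X Y Z : Cinf M :=
  vact X (w Y Z) - vact Y (w X Z) + vact Z (w X Y)
  - w (lie X Y) Z + w (lie X Z) Y - w (lie Y Z) X.

Definition closed_form2 w : Prop := forall X Y Z, d_form2 w X Y Z = 0.

End structures.

(* Main.v *)
(** The derivatives of the first arguments in [d_nablaJ] and [d_nablag] cancel
    against the torsion term, so that the two hypotheses say
    [J [X, Y] = D_X (J Y) - D_Y (J X)] and
    [X g(Y, Z) - Y g(X, Z) - g([X, Y], Z) = g(Y, D_X Z) - g(X, D_Y Z)].
    The first identity turns the Nijenhuis tensor into [T(JX, JY) - T(X, Y)],
    which the condition on the torsion kills.  Putting [J Z] for [Z] in the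
    second and summing cyclically over [X, Y, Z], the first identity gives
    [2 (d omega)(X, Y, Z) = 0]. *)
Require Import Defs.
From mathcomp Require Import all_boot all_order all_algebra.
From mathcomp Require Import reals.
From mathcomp Require Import lra.
Import GRing.Theory.
Local Open Scope ring_scope.

Section TensorCalculus.
Variables (R : realType) (m : nat) (M : manifold R m).
Implicit Types (f h : Cinf M) (X Y Z : vfield M) (D : connection M).
Implicit Types (g w : tensor02 M) (J : tensor11 M).

Lemma CinfDE f h p : (f + h) p = f p + h p.
Proof. by []. Qed.

Lemma CinfNE f p : (- f) p = - f p.
Proof. by []. Qed.

Definition CinfE := (CinfDE, CinfNE).

(** Testing on all points and functions turns an identity of vector fields into one of real numbers,
    where [lra] applies. *)
Lemma vfield_ext X Y : (forall p f, X p f = Y p f) -> X = Y.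
Proof. by move=> XY; apply: vfieldP => p; apply: tangentP => f; exact: XY. Qed.

Lemma vfieldDE X Y p f : (X + Y) p f = X p f + Y p f.
Proof. by []. Qed.

Lemma vfieldNE X p f : (- X) p f = - X p f.
Proof. by []. Qed.

Definition vfieldE := (vfieldDE, vfieldNE).

Lemma vactN X f : vact X (- f) = - vact X f.
Proof.
apply: CinfP => p /=; have [Xl _] := tangent_derivation (X p).
(* Linearity with scalar [-1] at [0, 0] gives [X p 0 = - X p 0 + X p 0]. *)
have X0 : X p 0 = 0 by have := Xl (-1) 0 0; rewrite !scaleN1r !addNr.
by have := Xl (-1) f 0; rewrite !scaleN1r X0 !addr0.
Qed.

Lemma lieE X Y p f : lie X Y p f = X p (vact Y f) - Y p (vact X f).
Proof. by []. Qed.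

Lemma lieC X Y : lie X Y = - lie Y X.
Proof. by apply: vfield_ext => p f; rewrite vfieldE !lieE opprB. Qed.

Lemma lieNl X Y : lie (- X) Y = - lie X Y.
Proof.
have vactNl f : vact (- X) f = - vact X f by exact: CinfP.
apply: vfield_ext => p f; rewrite vfieldE !lieE vactNl vfieldE.
(* [Y p] is refolded into [vact Y] so that [vactN] can move the sign out. *)
by rewrite -[Y p (- _)]/(vact Y (- vact X f) p) vactN CinfNE opprD.
Qed.

Lemma t11_appB J X Y : J (X - Y) = J X - J Y.
Proof. by apply: vfieldP => p /=; rewrite linearB. Qed.

Lemma almost_complexK J X : almost_complex J -> J (J X) = - X.
Proof. by move=> J_acs; apply: vfieldP => p; exact: J_acs. Qed.

Lemma t02_appDl g X Y Z : g (X + Y) Z = g X Z + g Y Z.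
Proof.
apply: CinfP => p /=.
by have := t02_linearl g (Z p) 1 (X p) (Y p); rewrite !scale1r.
Qed.

Lemma t02_appDr g X Y Z : g X (Y + Z) = g X Y + g X Z.
Proof.
apply: CinfP => p /=.
by have := t02_linearr g (X p) 1 (Y p) (Z p); rewrite !scale1r.
Qed.

Lemma t02_appNl g X Y : g (- X) Y = - g X Y.
Proof.
have g0 : g 0 Y = 0 by apply: (addrI (g 0 Y)); rewrite -t02_appDl !addr0.
by apply/eqP; rewrite -addr_eq0 -t02_appDl addNr g0.
Qed.

Lemma t02_appNr g X Y : g X (- Y) = - g X Y.
Proof.
have g0 : g X 0 = 0 by apply: (addrI (g X 0)); rewrite -t02_appDr !addr0.
by apply/eqP; rewrite -addr_eq0 -t02_appDr addNr g0.
Qed.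

Lemma t02_appC g X Y : pseudo_riemannian g -> g X Y = g Y X.
Proof. by move=> g_metric; apply: CinfP => p; exact: (g_metric p).1. Qed.

Lemma nablaNl D X Y : D (- X) Y = - D X Y.
Proof.
have D0 : D 0 Y = 0.
  by have := nabla_linearl D Y (-1) 0 0; rewrite !scaleN1r !addNr.
by have := nabla_linearl D Y (-1) X 0; rewrite !scaleN1r D0 !addr0.
Qed.

Lemma nablaNr D X Y : D X (- Y) = - D X Y.
Proof.
have D0 : D X 0 = 0 by apply: (addrI (D X 0)); rewrite -nabla_addr !addr0.
by apply/eqP; rewrite -addr_eq0 -nabla_addr addNr D0.
Qed.

Lemma torsionNl D X Y : torsion D (- X) Y = - torsion D X Y.
Proof. by rewrite /torsion nablaNl nablaNr lieNl !opprD. Qed.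

Lemma d_nablaJE D J X Y :
  d_nablaJ D J X Y = D X (J Y) - D Y (J X) - J (lie X Y).
Proof.
rewrite /d_nablaJ /nablaJ /torsion !t11_appB.
by apply: vfield_ext => p f; rewrite !vfieldE; lra.
Qed.

Lemma d_nablagE D g X Y Z :
  d_nablag D g X Y Z = vact X (g Y Z) - vact Y (g X Z) - g (lie X Y) Z
                       - g Y (D X Z) + g X (D Y Z).
Proof.
rewrite /d_nablag /nablag /torsion !(t02_appDl, t02_appNl).
by apply: CinfP => p; rewrite !CinfE; lra.
Qed.

Lemma t11_lie D J X Y : (forall U V, d_nablaJ D J U V = 0) ->
  J (lie X Y) = D X (J Y) - D Y (J X).
Proof. by move=> dJ0; apply/esym/eqP; rewrite -subr_eq0 -d_nablaJE dJ0. Qed.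

Lemma nijenhuis_torsion D J X Y : almost_complex J ->
  (forall U V, d_nablaJ D J U V = 0) ->
  nijenhuis J X Y = torsion D (J X) (J Y) - torsion D X Y.
Proof.
move=> J_acs dJ0.
(* [J (J (lie X Y))] is collapsed first, lest [t11_lie] expand its inner bracket. *)
rewrite /nijenhuis /torsion almost_complexK // !(t11_lie _ _ _ _ dJ0).
rewrite !almost_complexK // !nablaNr.
by apply: vfield_ext => p f; rewrite !vfieldE; lra.
Qed.

End TensorCalculus.

Section FundamentalForm.
Variables (R : realType) (m : nat) (M : manifold R m).
Variables (g w : tensor02 M) (J : tensor11 M).
Hypotheses (g_metric : pseudo_riemannian g) (J_acs : almost_complex J).
Hypothesis gwJ : compatible_triple g w J.
Implicit Types X Y Z : vfield M.

(** Apply [J] to both arguments: $g(X,JY)=g(JX,J^2Y)=-g(JX,Y)$. *)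
Lemma compatible_skew X Y : g X (J Y) = - w X Y.
Proof.
by rewrite gwJ.2 -[g X _]gwJ.1 almost_complexK // t02_appNr.
Qed.

Lemma fundamental_formC X Y : w X Y = - w Y X.
Proof. by rewrite -compatible_skew gwJ.2 t02_appC. Qed.

Lemma fundamental_form_closed (D : connection M) :
  (forall X Y, d_nablaJ D J X Y = 0) -> quasi_statistical D g ->
  closed_form2 w.
Proof.
move=> dJ0 stat X Y Z.
(* The condition $d^{\nabla}g=0$ at $(U,V,JW)$, where each $g(\cdot,JW)$ becomes
   $-\omega(\cdot,W)$. *)
have dgJ U V W : - vact U (w V W) + vact V (w U W) + w (lie U V) W
                 - g V (D U (J W)) + g U (D V (J W)) = 0.
  by rewrite -[RHS](stat U V (J W)) d_nablagE !compatible_skew !vactN !opprK.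
have w_lie U V W : w (lie U V) W = g W (D U (J V)) - g W (D V (J U)).
  by rewrite gwJ.2 (t11_lie _ _ _ _ _ _ _ dJ0) t02_appC // t02_appDr t02_appNr.
have vact_wC U V W : vact U (w V W) = - vact U (w W V).
  by rewrite [w V W]fundamental_formC vactN.
have w_lieC U V W : w (lie U V) W = - w (lie V U) W by rewrite lieC t02_appNl.
apply: CinfP => p.
have pt (f h : Cinf M) : f = h -> f p = h p by move->.
(* Let $S$ and $L$ be the cyclic sums of $X\omega(Y,Z)$ and $\omega([X,Y],Z)$, so that
   $d\omega=S-L$. By [w_lie] the connection terms of the three [dgJ] add up to $L$, so their total
   is $2L-2S=0$. *)
move: (pt _ _ (dgJ X Y Z)) (pt _ _ (dgJ Y Z X)) (pt _ _ (dgJ Z X Y)).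
move: (pt _ _ (w_lie X Y Z)) (pt _ _ (w_lie Y Z X)) (pt _ _ (w_lie Z X Y)).
(* Antisymmetry brings the remaining terms into cyclic order. *)
move: (pt _ _ (vact_wC X Z Y)) (pt _ _ (vact_wC Y X Z)) (pt _ _ (vact_wC Z Y X)).
move: (pt _ _ (w_lieC X Z Y)).
by rewrite /d_form2 !CinfE -[(0 : Cinf M) p]/(0 : R); lra.
Qed.

End FundamentalForm.

Theorem theorem1 (R : realType) (n : nat) (N : manifold R (2 * n)%N)
    (nabla : connection N) (g w : tensor02 N) (J : tensor11 N)
    (g_metric : pseudo_riemannian g) (J_acs : almost_complex J)
    (gwJ : compatible_triple g w J)
    (torsion_compat : forall X Y : vfield N,
       torsion nabla X (J Y) = - torsion nabla (J X) Y)
    (dJ0 : forall X Y : vfield N, d_nablaJ nabla J X Y = 0)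
    (stat : quasi_statistical nabla g) :
  integrable J /\ closed_form2 w.
Proof.
split.
  move=> X Y; rewrite (nijenhuis_torsion _ _ _ _ _ _ _ J_acs dJ0).
  (* $T(JX,JY)=-T(J^2X,Y)=T(X,Y)$. *)
  by rewrite torsion_compat almost_complexK // torsionNl opprK subrr.
exact: (fundamental_form_closed _ _ _ _ _ _ g_metric J_acs gwJ _ dJ0 stat).
Qed.
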